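(* For all $r,s,t\in\mathbb{Z}$, the Riordan array $$\left(\frac{1-(r-2t)x-(rt-s-t^2)x^2}{1+(r+2t)x+(rt+s+t^2)x^2},\ \frac{x}{1+(r+2t)x+(rt+s+t^2)x^2}\right)^{-1}\cdot\left(1,\ \frac{-x(1+2tx)}{1-(r-2t)x-(rt-s-t^2)x^2}\right)$$ is an involution in the Riordan group.
   Context: Let $\mathbf{k}$ be a field of characteristic zero (e.g. $\mathbb{C}$). $\mathbf{F}_0$ is the set of formal power series $g(x)=g_0+g_1x+g_2x^2+\cdots$ over $\mathbf{k}$ with $g_0\neq 0$; $\mathbf{F}_1$ is the set of formal power series $f(x)=f_1x+f_2x^2+\cdots$ over $\mathbf{k}$ with zero constant term and $f_1\neq 0$. The Riordan group is $\mathcal{R}=\{(g(x),f(x)) : g\in\mathbf{F}_0,\ f\in\mathbf{F}_1\}$ with product $$(g(x),f(x))\cdot(u(x),v(x))=(g(x)\,u(f(x)),\ v(f(x))),$$ identity $(1,x)$, and inverse $(g(x),f(x))^{-1}=\left(\frac{1}{g(\bar f(x))},\bar f(x)\right)$, where $\bar f$ is the compositional inverse of $f$. Elements of $\mathcal{R}$ are called Riordan arrays (the pair $(g,f)$ is identified with the lower-triangular matrix with $(n,k)$ entry $[x^n]g(x)f(x)^k$, the product corresponding to matrix multiplication). Rational functions are understood as their power series expansions at $x=0$. An involution in $\mathcal{R}$ is an element $A\in\mathcal{R}$ with $A\cdot A=(1,x)$. *)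

(* Defs.v *)
(* Formal power series over a field and the Riordan group. Classical axioms are
   used only for extensionality and to obtain choiceType structures. *)
From HB Require Import structures.
From mathcomp Require Import all_boot all_order all_algebra.
From mathcomp Require Import boolp.

Set Implicit Arguments.
Unset Strict Implicit.
Unset Printing Implicit Defensive.

Import GRing.Theory.
Local Open Scope ring_scope.

(* The solution h of the lower triangular linear system
   \sum_(k <= n) L n k * h k = b n, when the L n n are nonzero. *)
Section LowerTriangular.
Variables (K : fieldType) (L : nat -> nat -> K) (b : nat -> K).

Fixpoint tsolve_seq n : seq K :=
  if n is m.+1 then
    let s := tsolve_seq m in
    rcons s ((b m - \sum_(k < m) L m k * s`_k) / L m m)
  else [::].

Definition tsolve n := (tsolve_seq n.+1)`_n.

Lemma size_tsolve_seq n : size (tsolve_seq n) = n.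
Proof. by elim: n => //= n IHn; rewrite size_rcons IHn. Qed.

Lemma nth_tsolve_seq n k : (k < n)%N -> (tsolve_seq n)`_k = tsolve k.
Proof.
elim: n => // n IHn; rewrite ltnS leq_eqVlt => /predU1P[-> // | lt_kn].
by rewrite /= nth_rcons size_tsolve_seq lt_kn IHn.
Qed.

Lemma tsolveE n :
  tsolve n = (b n - \sum_(k < n) L n k * tsolve k) / L n n.
Proof.
rewrite /tsolve /= nth_rcons size_tsolve_seq ltnn eqxx.
by congr ((_ - _) / _); apply: eq_bigr => k _; rewrite nth_tsolve_seq.
Qed.

Lemma tsolveP n : L n n != 0 -> \sum_(k < n.+1) L n k * tsolve k = b n.
Proof.
move=> Lnn; rewrite big_ord_recr /= (tsolveE n) [L n n * _]mulrC divfK //.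
by rewrite addrC subrK.
Qed.

End LowerTriangular.

Record fps (K : Type) := Fps { fps_coef :> nat -> K }.

Lemma fpsP (K : Type) (a b : fps K) : a =1 b <-> a = b.
Proof.
by split=> [|-> //]; case: a b => [a] [b] /= /funext->.
Qed.

HB.instance Definition _ (K : Type) := gen_eqMixin (fps K).
HB.instance Definition _ (K : Type) := gen_choiceMixin (fps K).

Section FpsZmodule.
Variable K : fieldType.
Implicit Types a b c : fps K.

Definition fps0 : fps K := Fps (fun=> 0).
Definition fps_opp a : fps K := Fps (fun n => - a n).
Definition fps_add a b : fps K := Fps (fun n => a n + b n).

Fact fps_addA : associative fps_add.
Proof. by move=> a b c; apply/fpsP => n /=; rewrite addrA. Qed.
Fact fps_addC : commutative fps_add.
Proof. by move=> a b; apply/fpsP => n /=; rewrite addrC. Qed.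
Fact fps_add0 : left_id fps0 fps_add.
Proof. by move=> a; apply/fpsP => n /=; rewrite add0r. Qed.
Fact fps_addN : left_inverse fps0 fps_opp fps_add.
Proof. by move=> a; apply/fpsP => n /=; rewrite addNr. Qed.

HB.instance Definition _ :=
  GRing.isZmodule.Build (fps K) fps_addA fps_addC fps_add0 fps_addN.

End FpsZmodule.

Section FpsRing.
Variable K : fieldType.
Implicit Types a b c : fps K.

Lemma coef_fps0 n : (0 : fps K) n = 0. Proof. by []. Qed.
Lemma coef_fpsN a n : (- a) n = - a n. Proof. by []. Qed.
Lemma coef_fpsD a b n : (a + b) n = a n + b n. Proof. by []. Qed.

Definition fpsC (x : K) : fps K := Fps (fun n => if n == 0%N then x else 0).
Definition fps_mul a b : fps K :=
  Fps (fun n => \sum_(i < n.+1) a i * b (n - i)%N).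

Definition fps_trunc N a : {poly K} := \poly_(i < N) a i.

Lemma coef_fps_trunc N a i : (i < N)%N -> (fps_trunc N a)`_i = a i.
Proof. by move=> lt_iN; rewrite coef_poly lt_iN. Qed.

Lemma fps_mul_trunc N a b n : (n < N)%N ->
  fps_mul a b n = (fps_trunc N a * fps_trunc N b)`_n.
Proof.
move=> lt_nN; rewrite coefM; apply: eq_bigr => i _.
have le_in : (i <= n)%N by rewrite -ltnS.
by rewrite !coef_fps_trunc // (leq_ltn_trans _ lt_nN) // leq_subr.
Qed.

Fact fps_mulC : commutative fps_mul.
Proof.
by move=> a b; apply/fpsP => n; rewrite !(@fps_mul_trunc n.+1) // mulrC.
Qed.

Fact fps_mulA : associative fps_mul.
Proof.
move=> a b c; apply/fpsP => n.
have E (u v w : fps K) : fps_mul u (fps_mul v w) n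
    = (fps_trunc n.+1 u * (fps_trunc n.+1 v * fps_trunc n.+1 w))`_n.
  rewrite (@fps_mul_trunc n.+1) // [LHS]coefM [RHS]coefM; apply: eq_bigr => i _.
  have ltn : (n - i < n.+1)%N by rewrite ltnS leq_subr.
  by congr (_ * _); rewrite coef_fps_trunc // (fps_mul_trunc _ _ ltn).
rewrite E [fps_mul (fps_mul a b) c]fps_mulC E; congr (polyseq _)`_n.
by rewrite mulrA [RHS]mulrC.
Qed.

Fact fps_mul1 : left_id (fpsC 1) fps_mul.
Proof.
move=> a; apply/fpsP => n /=; rewrite big_ord_recl /= mul1r subn0.
by rewrite big1 ?addr0 // => i _; rewrite mul0r.
Qed.

Fact fps_mulDl : left_distributive fps_mul +%R.
Proof.
move=> a b c; apply/fpsP => n; rewrite coef_fpsD /= -big_split /=.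
by apply: eq_bigr => i _; rewrite mulrDl.
Qed.

Fact fps_1_neq0 : fpsC 1 != 0.
Proof.
apply/eqP => /(congr1 (fun a : fps K => a 0%N)) /= /eqP.
by rewrite oner_eq0.
Qed.

HB.instance Definition _ := GRing.Zmodule_isComNzRing.Build (fps K)
  fps_mulA fps_mulC fps_mul1 fps_mulDl fps_1_neq0.

Lemma coef_fpsM a b n : (a * b) n = \sum_(i < n.+1) a i * b (n - i)%N.
Proof. by []. Qed.
Lemma coef_fps1 n : (1 : fps K) n = (n == 0%N)%:R.
Proof. by rewrite /=; case: eqP. Qed.
Lemma coef_fpsM0 a b : (a * b) 0%N = a 0%N * b 0%N.
Proof. by rewrite coef_fpsM big_ord1. Qed.

Definition fps_unit : {pred fps K} := [pred a : fps K | a 0%N != 0].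
(* On the non-units the ring structure imposes the identity. *)
Definition fps_inv a : fps K :=
  if a 0%N != 0 then
    Fps (tsolve (fun n k => a (n - k)%N) (fps_coef (1 : fps K)))
  else a.

Fact fps_mulV : {in fps_unit, left_inverse 1 fps_inv *%R}.
Proof.
move=> a; rewrite inE => a0; apply/fpsP => n; rewrite mulrC coef_fpsM.
rewrite (reindex_inj rev_ord_inj) /= /fps_inv a0 /=.
rewrite -[RHS](@tsolveP _ (fun n k => a (n - k)%N) (fps_coef 1) n) ?subnn //.
by apply: eq_bigr => i _; rewrite subSS subKn // -ltnS.
Qed.

Fact fps_unitP a b : b * a = 1 -> fps_unit a.
Proof.
move=> /(congr1 (fun c : fps K => c 0%N)).
rewrite coef_fpsM0 coef_fps1 /= => ba1; apply/eqP => a0.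
by move/eqP: ba1; rewrite a0 mulr0 eq_sym oner_eq0.
Qed.

Fact fps_inv_out : {in [predC fps_unit], fps_inv =1 id}.
Proof. by move=> a; rewrite !inE /fps_inv => /negbTE->. Qed.

HB.instance Definition _ := GRing.ComNzRing_hasMulInverse.Build (fps K)
  fps_mulV fps_unitP fps_inv_out.

Lemma fps_unitE a : (a \is a GRing.unit) = (a 0%N != 0). Proof. by []. Qed.

Fact fpsC_is_additive : additive fpsC.
Proof. by move=> x y; apply/fpsP => -[|n] /=; rewrite ?subr0. Qed.
Fact fpsC_is_monoid_morphism : monoid_morphism fpsC.
Proof.
split=> // x y; apply/fpsP => n; rewrite coef_fpsM big_ord_recl subn0 /=.
by rewrite big1 => [|i _]; rewrite ?mul0r // addr0; case: n => //=; rewrite mulr0.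
Qed.
HB.instance Definition _ :=
  GRing.isAdditive.Build K (fps K) fpsC fpsC_is_additive.
HB.instance Definition _ :=
  GRing.isMonoidMorphism.Build K (fps K) fpsC fpsC_is_monoid_morphism.

Definition fpsX : fps K := Fps (fun n => (n == 1%N)%:R).

End FpsRing.

Section Composition.
Variable K : fieldType.
Implicit Types (a b f g h : fps K) (p q : {poly K}).

(* The power series a(f(x)). As f ^+ k has no coefficient of degree less than k
   when f 0 = 0, truncating the sum at k = n is then legitimate; the value is
   meaningless when f 0 != 0. *)
Definition fps_comp a f : fps K :=
  Fps (fun n => \sum_(k < n.+1) a k * (f ^+ k) n).

Lemma coef_fps_comp a f n :
  fps_comp a f n = \sum_(k < n.+1) a k * (f ^+ k) n.
Proof. by []. Qed.

Definition fps_eqm N a b := forall n, (n < N)%N -> a n = b n.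

Lemma fps_eqmP a b : (forall N, fps_eqm N a b) -> a = b.
Proof. by move=> eq_ab; apply/fpsP => n; apply: (eq_ab n.+1). Qed.

Lemma fps_eqm_trans N b a c : fps_eqm N a b -> fps_eqm N b c -> fps_eqm N a c.
Proof. by move=> ab bc n ltnN; rewrite ab ?bc. Qed.

Lemma fps_eqm_sym N a b : fps_eqm N a b -> fps_eqm N b a.
Proof. by move=> ab n ltnN; rewrite ab. Qed.

Lemma fps_eqmM N a a' b b' :
  fps_eqm N a a' -> fps_eqm N b b' -> fps_eqm N (a * b) (a' * b').
Proof.
move=> eqa eqb n ltnN; rewrite !coef_fpsM; apply: eq_bigr => i _.
rewrite eqa ?eqb // (leq_ltn_trans _ ltnN) ?leq_subr //.
by rewrite -ltnS.
Qed.

Lemma coef_fpsX_lt f k n : f 0%N = 0 -> (n < k)%N -> (f ^+ k) n = 0.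
Proof.
move=> f0; elim: k n => // k IHk n; rewrite ltnS => lenk.
rewrite exprS coef_fpsM big_ord_recl f0 mul0r add0r.
apply: big1 => i _; rewrite IHk ?mulr0 //= /bump /= add1n.
have lt_in := ltn_ord i; rewrite (leq_trans _ lenk) //.
by rewrite ltn_subrL (leq_ltn_trans _ lt_in).
Qed.

Lemma coef_fpsX_diag f k : f 0%N = 0 -> (f ^+ k) k = f 1%N ^+ k.
Proof.
move=> f0; elim: k => [|k IHk]; first by rewrite !expr0.
rewrite exprS coef_fpsM !big_ord_recl f0 mul0r add0r /= /bump /= subSS subn0.
rewrite IHk exprS big1 ?addr0 // => i _.
rewrite coef_fpsX_lt ?mulr0 // !add1n subSS ltn_subrL.
by case: k i {IHk} => // -[].
Qed.

Lemma coef_sumf (I : Type) (r : seq I) (P : pred I) (F : I -> fps K) n :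
  (\sum_(i <- r | P i) F i) n = \sum_(i <- r | P i) F i n.
Proof. by elim/big_rec2: _ => // i x y _ <-. Qed.

Lemma coef_fpsCM x a n : (fpsC x * a) n = x * a n.
Proof.
rewrite coef_fpsM big_ord_recl subn0 /= big1 ?addr0 // => i _.
by rewrite mul0r.
Qed.

Definition fps_horner p f : fps K := (map_poly (@fpsC K) p).[f].

Lemma coef_fps_horner p f N n : f 0%N = 0 -> (n < N)%N ->
  fps_horner p f n = \sum_(k < N) p`_k * (f ^+ k) n.
Proof.
move=> f0 ltnN; pose M := maxn N (size p).
have sM : (size (map_poly (@fpsC K) p) <= M)%N.
  by rewrite (leq_trans (size_poly _ _)) // leq_maxr.
rewrite /fps_horner (horner_coef_wide _ sM) coef_sumf.
transitivity (\sum_(k < M) p`_k * (f ^+ k) n).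
  by apply: eq_bigr => k _; rewrite coef_map coef_fpsCM.
rewrite -!(big_mkord xpredT (fun k => p`_k * (f ^+ k) n)).
rewrite (big_cat_nat (n := N)) ?leq_maxl //=.
rewrite [X in _ + X]big_nat_cond [X in _ + X]big1 ?addr0 // => k.
by rewrite andbT => /andP[leNk _]; rewrite coef_fpsX_lt ?mulr0 // (leq_trans ltnN).
Qed.

Lemma fps_comp_horner N a f :
  f 0%N = 0 -> fps_eqm N (fps_comp a f) (fps_horner (fps_trunc N a) f).
Proof.
move=> f0 n ltnN; rewrite (@coef_fps_horner _ _ n.+1) //=.
apply: eq_bigr => k _; rewrite coef_fps_trunc //.
exact: leq_trans (ltn_ord k) ltnN.
Qed.

Lemma fps_comp_eqm N a b f :
  fps_eqm N a b -> fps_eqm N (fps_comp a f) (fps_comp b f).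
Proof.
move=> eq_ab n ltnN /=; apply: eq_bigr => k _; rewrite eq_ab //.
exact: leq_trans (ltn_ord k) ltnN.
Qed.

Lemma fps_horner_eqm N p q f : f 0%N = 0 ->
  (forall n, (n < N)%N -> p`_n = q`_n) ->
  fps_eqm N (fps_horner p f) (fps_horner q f).
Proof.
move=> f0 eq_pq n ltnN; rewrite !(@coef_fps_horner _ _ n.+1) //.
apply: eq_bigr => k _; rewrite eq_pq //.
exact: leq_trans (ltn_ord k) ltnN.
Qed.

Lemma fps_compC x f : fps_comp (fpsC x) f = fpsC x.
Proof.
apply/fpsP => n; rewrite coef_fps_comp big_ord_recl expr0 coef_fps1.
rewrite big1 ?addr0 => [|i _]; last by rewrite mul0r.
by rewrite /=; case: eqP; rewrite ?mulr1 ?mulr0.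
Qed.

Lemma fps_comp1 f : fps_comp 1 f = 1. Proof. exact: fps_compC. Qed.

Lemma fps_compD a b f : fps_comp (a + b) f = fps_comp a f + fps_comp b f.
Proof.
apply/fpsP => n; rewrite coef_fpsD /= -big_split /=.
by apply: eq_bigr => k _; rewrite /= mulrDl.
Qed.

Lemma fps_compN a f : fps_comp (- a) f = - fps_comp a f.
Proof.
apply/fpsP => n; rewrite coef_fpsN /= -sumrN.
by apply: eq_bigr => k _; rewrite /= mulNr.
Qed.

Lemma fps_compM a b f : f 0%N = 0 ->
  fps_comp (a * b) f = fps_comp a f * fps_comp b f.
Proof.
move=> f0; apply: fps_eqmP => N.
apply: fps_eqm_trans (fps_comp_horner _ f0) _.
apply: fps_eqm_trans (fps_eqm_sym (fps_eqmM (fps_comp_horner a f0)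
  (fps_comp_horner b f0))).
rewrite /fps_horner -hornerM -rmorphM; apply: fps_horner_eqm => // n ltnN.
by rewrite coef_fps_trunc // -(fps_mul_trunc _ _ ltnN).
Qed.

Lemma fps_compXn a f k : f 0%N = 0 -> fps_comp (a ^+ k) f = fps_comp a f ^+ k.
Proof.
move=> f0; elim: k => [|k IHk]; first by rewrite !expr0 fps_comp1.
by rewrite !exprS fps_compM // IHk.
Qed.

Lemma fps_comp_sum (I : Type) (r : seq I) (F : I -> fps K) f :
  fps_comp (\sum_(i <- r) F i) f = \sum_(i <- r) fps_comp (F i) f.
Proof.
elim: r => [|i r IHr]; rewrite ?big_nil ?big_cons ?fps_compD ?IHr //.
by rewrite -(rmorph0 (@fpsC K)) fps_compC.
Qed.

Lemma fps_compV a f : f 0%N = 0 -> a 0%N != 0 ->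
  fps_comp a^-1 f = (fps_comp a f)^-1.
Proof.
move=> f0 a0; have ua : a \is a GRing.unit by [].
have E : fps_comp a^-1 f * fps_comp a f = 1.
  by rewrite -fps_compM // mulVr // fps_comp1.
have uaf : fps_comp a f \is a GRing.unit.
  rewrite fps_unitE; exact: fps_unitP E.
by apply: (mulIr uaf); rewrite E mulVr.
Qed.

Lemma fps_comp0 a f : fps_comp a f 0%N = a 0%N.
Proof. by rewrite coef_fps_comp big_ord1 expr0 coef_fps1 mulr1. Qed.

Lemma fps_comp_coef1 a f : fps_comp a f 1%N = a 1%N * f 1%N.
Proof.
rewrite coef_fps_comp !big_ord_recl big_ord0 expr0 coef_fps1 expr1 mulr0.
by rewrite add0r addr0.
Qed.

Lemma fps_compA a f h : f 0%N = 0 -> h 0%N = 0 ->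
  fps_comp (fps_comp a f) h = fps_comp a (fps_comp f h).
Proof.
move=> f0 h0; have fh0 : fps_comp f h 0%N = 0 by rewrite fps_comp0.
apply: fps_eqmP => N.
apply: fps_eqm_trans (fps_comp_eqm _ (fps_comp_horner a f0)) _.
apply: fps_eqm_trans (fps_eqm_sym (fps_comp_horner a fh0)).
rewrite /fps_horner !horner_coef fps_comp_sum => n _; congr (fps_coef _ n).
by apply: eq_bigr => i _; rewrite fps_compM // coef_map fps_compC fps_compXn.
Qed.

Lemma fps_compX f : f 0%N = 0 -> fps_comp (fpsX K) f = f.
Proof.
move=> f0; apply/fpsP => -[|n]; first by rewrite fps_comp0 f0.
rewrite coef_fps_comp !big_ord_recl /= mul0r add0r mul1r expr1 big1 ?addr0 // => i _.
by rewrite mul0r.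
Qed.

Lemma fpsX_exp k n : (fpsX K ^+ k) n = (n == k)%:R.
Proof.
elim: k n => [|k IHk] n; first by rewrite expr0 coef_fps1.
rewrite exprS coef_fpsM big_ord_recl mul0r add0r.
case: n => [|n]; first by rewrite big_ord0.
rewrite big_ord_recl /= mul1r subSS subn0 IHk eqSS big1 ?addr0 // => i _.
by rewrite mul0r.
Qed.

Lemma fps_comp_X a : fps_comp a (fpsX K) = a.
Proof.
apply/fpsP => n; rewrite coef_fps_comp big_ord_recr /= fpsX_exp eqxx mulr1.
rewrite big1 ?add0r // => i _; rewrite fpsX_exp.
by rewrite gtn_eqF ?mulr0.
Qed.

(* The compositional inverse of f, determined by the equations
   \sum_(k <= n) fbar_k [x^n] f^k = [x^n] x, when f 0 = 0 and f 1 != 0. *)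
Definition fps_compinv f : fps K :=
  Fps (tsolve (fun n k => (f ^+ k) n) (fps_coef (fpsX K))).

Lemma fps_compinvl f : f 0%N = 0 -> f 1%N != 0 ->
  fps_comp (fps_compinv f) f = fpsX K.
Proof.
move=> f0 f1; apply/fpsP => n.
rewrite -[RHS](@tsolveP _ (fun n k => (f ^+ k) n)) /=.
  by apply: eq_bigr => k _; rewrite mulrC.
by rewrite coef_fpsX_diag // expf_neq0.
Qed.

Lemma fps_compinv_coef0 f : fps_compinv f 0%N = 0.
Proof. by rewrite /= tsolveE big_ord0 subr0 mul0r. Qed.

Lemma fps_compinv_coef1 f :
  f 0%N = 0 -> f 1%N != 0 -> fps_compinv f 1%N != 0.
Proof.
move=> f0 f1; apply/eqP => fb1.
have := fps_comp_coef1 (fps_compinv f) f.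
rewrite fps_compinvl // fb1 mul0r /= => /eqP.
by rewrite oner_eq0.
Qed.

Lemma fps_compinvr f : f 0%N = 0 -> f 1%N != 0 ->
  fps_comp f (fps_compinv f) = fpsX K.
Proof.
move=> f0 f1; set fb := fps_compinv f.
have fb0 : fb 0%N = 0 := fps_compinv_coef0 f.
have fb1 : fb 1%N != 0 := fps_compinv_coef1 f0 f1.
have fE : f = fps_compinv fb.
  by rewrite -[LHS](fps_compX f0) -(fps_compinvl fb0 fb1) fps_compA //
    fps_compinvl // fps_comp_X.
by rewrite [X in fps_comp X _]fE fps_compinvl.
Qed.

End Composition.

Definition F0 (K : fieldType) : {pred fps K} := [pred g : fps K | g 0%N != 0].
Definition F1 (K : fieldType) : {pred fps K} :=
  [pred f : fps K | (f 0%N == 0) && (f 1%N != 0)].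
Arguments F0 {K}.
Arguments F1 {K}.

Record riordan (K : fieldType) := Riordan {
  riordan_g : fps K;
  riordan_f : fps K;
  riordan_gP : riordan_g \in F0;
  riordan_fP : riordan_f \in F1
}.
Arguments Riordan {K} (riordan_g riordan_f)%_ring_scope riordan_gP riordan_fP.

HB.instance Definition _ (K : fieldType) := gen_eqMixin (riordan K).
HB.instance Definition _ (K : fieldType) := gen_choiceMixin (riordan K).

Section RiordanGroup.
Variable K : fieldType.
Implicit Types A B C : riordan K.

Lemma riordan_eq A B :
  riordan_g A = riordan_g B -> riordan_f A = riordan_f B -> A = B.
Proof.
case: A B => [g f gP fP] [u v uP vP] /= eg ef; case: _ / eg uP => uP.
case: _ / ef vP => vP.
by rewrite (bool_irrelevance uP gP) (bool_irrelevance vP fP).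
Qed.

Lemma F1_coef0 (f : fps K) : f \in F1 -> f 0%N = 0.
Proof. by case/andP => /eqP. Qed.
Lemma F1_coef1 (f : fps K) : f \in F1 -> f 1%N != 0.
Proof. by case/andP. Qed.

Lemma F0_1 : (1 : fps K) \in F0.
Proof. by rewrite inE coef_fps1 oner_neq0. Qed.
Lemma F1_X : fpsX K \in F1.
Proof. by rewrite inE /= eqxx oner_neq0. Qed.
Lemma F0_M (g u : fps K) : g \in F0 -> u \in F0 -> g * u \in F0.
Proof. by rewrite !inE coef_fpsM0; apply: mulf_neq0. Qed.
Lemma F0_V (g : fps K) : g \in F0 -> g^-1 \in F0.
Proof. by move=> gP; have : g^-1 \is a GRing.unit by rewrite unitrV. Qed.
Lemma F0_comp (g f : fps K) : g \in F0 -> fps_comp g f \in F0.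
Proof. by rewrite !inE fps_comp0. Qed.
Lemma F1_comp (v f : fps K) : v \in F1 -> f \in F1 -> fps_comp v f \in F1.
Proof.
rewrite !inE fps_comp0 fps_comp_coef1 => /andP[-> v1] /andP[_ f1].
exact: mulf_neq0.
Qed.
Lemma F1_compinv (f : fps K) : f \in F1 -> fps_compinv f \in F1.
Proof.
move=> fP; rewrite inE fps_compinv_coef0 eqxx fps_compinv_coef1 //.
  exact: F1_coef0.
exact: F1_coef1.
Qed.

Definition riordan_one := Riordan 1 (fpsX K) F0_1 F1_X.

Definition riordan_mul A B := Riordan
  (riordan_g A * fps_comp (riordan_g B) (riordan_f A))
  (fps_comp (riordan_f B) (riordan_f A))
  (F0_M (riordan_gP A) (F0_comp _ (riordan_gP B)))
  (F1_comp (riordan_fP B) (riordan_fP A)).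

Definition riordan_inv A := Riordan
  (fps_comp (riordan_g A) (fps_compinv (riordan_f A)))^-1
  (fps_compinv (riordan_f A))
  (F0_V (F0_comp _ (riordan_gP A)))
  (F1_compinv (riordan_fP A)).

Fact riordan_mulA : associative riordan_mul.
Proof.
move=> A B C; have [fA fB] := (F1_coef0 (riordan_fP A), F1_coef0 (riordan_fP B)).
by apply: riordan_eq; rewrite /= ?fps_compM // ?fps_compA // mulrA.
Qed.

Fact riordan_mul1 : left_id riordan_one riordan_mul.
Proof. by move=> A; apply: riordan_eq; rewrite /= fps_comp_X ?mul1r. Qed.

Fact riordan_1mul : right_id riordan_one riordan_mul.
Proof.
move=> A; apply: riordan_eq; rewrite /= ?fps_comp1 ?mulr1 //.
by rewrite fps_compX // (F1_coef0 (riordan_fP A)).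
Qed.

Fact riordan_mulV : left_inverse riordan_one riordan_inv riordan_mul.
Proof.
move=> A; have [f0 f1] := (F1_coef0 (riordan_fP A), F1_coef1 (riordan_fP A)).
apply: riordan_eq; rewrite /= ?fps_compinvr //.
by rewrite mulVr // fps_unitE fps_comp0; apply: (riordan_gP A).
Qed.

Fact riordan_Vmul : right_inverse riordan_one riordan_inv riordan_mul.
Proof.
move=> A; have [f0 f1] := (F1_coef0 (riordan_fP A), F1_coef1 (riordan_fP A)).
have gP := riordan_gP A; apply: riordan_eq; rewrite /= ?fps_compinvl //.
rewrite fps_compV // ?fps_comp0 // fps_compA ?fps_compinv_coef0 //.
by rewrite fps_compinvl // fps_comp_X mulrV.
Qed.

HB.instance Definition _ := isGroup.Build (riordan K)
  riordan_mulA riordan_mul1 riordan_1mul riordan_mulV riordan_Vmul.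

End RiordanGroup.

Definition is_involution (G : groupType) (A : G) := (A * A = 1)%g.

Section Membership.
Variable K : fieldType.
Implicit Types c d u v : fps K.
Local Notation x := (fpsX K).

Lemma F0_lin c : 1 + c * x \in F0.
Proof. by rewrite inE coef_fpsD coef_fpsM0 mulr0 addr0 oner_neq0. Qed.

Lemma F0_quadD c d : 1 + c * x + d * x ^+ 2 \in F0.
Proof.
by rewrite inE !coef_fpsD !coef_fpsM0 !mulr0 !addr0 oner_neq0.
Qed.

Lemma F0_quadB c d : 1 - c * x - d * x ^+ 2 \in F0.
Proof. by have := F0_quadD (- c) (- d); rewrite !mulNr. Qed.

Lemma F0_div u v : u \in F0 -> v \in F0 -> u / v \in F0.
Proof. by move=> uP vP; apply: F0_M => //; apply: F0_V. Qed.

Lemma F1_mulX u : u \in F0 -> x * u \in F1.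
Proof.
rewrite !inE coef_fpsM0 mul0r eqxx coef_fpsM !big_ord_recl big_ord0 /=.
by rewrite mul0r add0r addr0 mul1r.
Qed.

Lemma F1_divX v : v \in F0 -> x / v \in F1.
Proof. by move=> vP; apply: F1_mulX; apply: F0_V. Qed.

Lemma F1_opp u : u \in F1 -> - u \in F1.
Proof. by rewrite !inE !coef_fpsN !oppr_eq0. Qed.

Lemma F1_NmulX_div u v : u \in F0 -> v \in F0 -> - x * u / v \in F1.
Proof.
by move=> uP vP; rewrite !mulNr -mulrA F1_opp // F1_mulX // F0_div.
Qed.

End Membership.

(* Main.v *)
(* Put w = - x / (1 + 2 t x), a compositional involution, and let N and D be the
   numerator and denominator of the first component g = N / D of A. Then
   N(w) (1 + 2 t x)^2 = D and D(w) (1 + 2 t x)^2 = N, so that g * g(w) = 1 and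
   S = (g, w) is an involution with S * A = B. Hence A^-1 * B = A^-1 * S * A is
   conjugate to S. *)
Require Import Defs.
From mathcomp Require Import all_boot all_order all_algebra.
From mathcomp Require Import ring.

Import GRing.Theory.
Local Open Scope ring_scope.

(** In the square the inner [A * A^-1] cancels, leaving [S * S] between [A^-1] and [A]. The
    bracketing keeps [S * A] whole, ready to stand for [B]. *)
Lemma conjg_involution (G : groupType) (A S : G) :
  is_involution S -> is_involution (A^-1 * (S * A))%g.
Proof.
rewrite /is_involution => SS.
by rewrite -!mulgA mulVKg [(S * (S * A))%g]mulgA SS mul1g mulVg.
Qed.

(** An integer scalar is a constant series, which no substitution changes. *)
Lemma fps_comp_int (K : fieldType) (n : int) (f : fps K) :
  fps_comp n%:~R f = n%:~R.
Proof. by rewrite -(rmorph_int (@fpsC K)) fps_compC. Qed.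

Lemma fps_comp_lin (K : fieldType) (a : int) (f : fps K) : f 0%N = 0 ->
  fps_comp (1 + a%:~R * fpsX K) f = 1 + a%:~R * f.
Proof.
by move=> f0; rewrite fps_compD fps_comp1 fps_compM // fps_comp_int fps_compX.
Qed.

Lemma fps_comp_quadD (K : fieldType) (a b : int) (f : fps K) : f 0%N = 0 ->
  fps_comp (1 + a%:~R * fpsX K + b%:~R * fpsX K ^+ 2) f
    = 1 + a%:~R * f + b%:~R * f ^+ 2.
Proof.
move=> f0; rewrite fps_compD fps_comp_lin // fps_compM // fps_comp_int.
by rewrite fps_compXn // fps_compX.
Qed.

Lemma fps_comp_quadB (K : fieldType) (a b : int) (f : fps K) : f 0%N = 0 ->
  fps_comp (1 - a%:~R * fpsX K - b%:~R * fpsX K ^+ 2) f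
    = 1 - a%:~R * f - b%:~R * f ^+ 2.
Proof.
by move=> f0; rewrite -!mulNr -!rmorphN /= fps_comp_quadD.
Qed.

Theorem proposition13 (K : fieldType) (charK0 : [pchar K] =i pred0)
    (r s t : int) :
  let x : fps K := fpsX K in
  let A : riordan K :=
    Riordan
      ((1 - (r - 2 * t)%:~R * x - (r * t - s - t ^+ 2)%:~R * x ^+ 2)
         / (1 + (r + 2 * t)%:~R * x + (r * t + s + t ^+ 2)%:~R * x ^+ 2))
      (x / (1 + (r + 2 * t)%:~R * x + (r * t + s + t ^+ 2)%:~R * x ^+ 2))
      (F0_div (F0_quadB _ _) (F0_quadD _ _))
      (F1_divX (F0_quadD _ _)) in
  let B : riordan K :=
    Riordan
      1
      (- x * (1 + (2 * t)%:~R * x)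
         / (1 - (r - 2 * t)%:~R * x - (r * t - s - t ^+ 2)%:~R * x ^+ 2))
      (F0_1 K)
      (F1_NmulX_div (F0_lin _) (F0_quadB _ _)) in
  is_involution (A^-1 * B)%g.
Proof.
move=> x A B.
pose N : fps K := 1 - (r - 2 * t)%:~R * x - (r * t - s - t ^+ 2)%:~R * x ^+ 2.
pose D : fps K := 1 + (r + 2 * t)%:~R * x + (r * t + s + t ^+ 2)%:~R * x ^+ 2.
pose u : fps K := 1 + (2 * t)%:~R * x; pose w := - x * u^-1.
have uP : u \in F0 := F0_lin _.
have NP : N \in F0 := F0_quadB _ _.
have DP : D \in F0 := F0_quadD _ _.
have uV : u * u^-1 = 1 by rewrite mulrV.
have wP : w \in F1 by rewrite /w mulNr F1_opp // F1_divX.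
have w0 : w 0%N = 0 := F1_coef0 wP.
have ww : fps_comp w w = x.
  (* This gives [w(w) = - w / u(w) = - w * u = x]. *)
  have uw : fps_comp u w = u^-1.
    rewrite fps_comp_lin //.
    transitivity (u * u^-1 + (2 * t)%:~R * w); first by rewrite uV.
    by rewrite /w {1}/u; ring.
  rewrite {1}/w fps_compM // fps_compV // uw invrK fps_compN fps_compX //.
  by rewrite mulNr divrK // opprK.
have Dw : fps_comp D w = N * u^-1 ^+ 2.
  rewrite fps_comp_quadD //.
  (* Factors [u * u^-1 = 1] make every term homogeneous of degree 2 in [u^-1], since
     [w = - x * u^-1]. *)
  transitivity ((u * u^-1) ^+ 2 + (r + 2 * t)%:~R * w * (u * u^-1)
    + (r * t + s + t ^+ 2)%:~R * w ^+ 2); first by rewrite uV expr1n mulr1.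
  (* The identity is now polynomial and holds for an arbitrary [v] in place of [u^-1]. *)
  by rewrite /w /N; move: (u^-1) => v; rewrite /u; ring.
have Nw : fps_comp N w = D * u^-1 ^+ 2.
  rewrite fps_comp_quadB //.
  transitivity ((u * u^-1) ^+ 2 - (r - 2 * t)%:~R * w * (u * u^-1)
    - (r * t - s - t ^+ 2)%:~R * w ^+ 2); first by rewrite uV expr1n mulr1.
  by rewrite /w /D; move: (u^-1) => v; rewrite /u; ring.
have u2 : u^-1 ^+ 2 \is a GRing.unit by rewrite unitrX // unitrV.
have ggw : N / D * fps_comp (N / D) w = 1.
  (* Substituting [w] swaps [N] and [D] up to the common unit [q], which cancels in the quotient. *)
  rewrite fps_compM // fps_compV // Nw Dw; move: (u^-1 ^+ 2) u2 => q Uq.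
  by rewrite invrM // -!mulrA mulKr // mulVKr // mulrV.
pose S := Riordan (N / D) w (F0_div NP DP) wP.
have SS : is_involution S by apply: riordan_eq.
suff -> : B = (S * A)%g by apply: conjg_involution.
apply: riordan_eq; rewrite /= ?ggw // fps_compM // fps_compV // fps_compX // Dw.
(* The second component is [w / D(w) = w * u ^+ 2 / N = - x * u / N]. *)
rewrite invrM // /w -exprVn invrK expr2 -!mulrA; congr (_ * _).
by rewrite mulKr.
Qed.
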